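(* Let $N$ be a natural number and let $\Gamma$ be a subgroup of $\mathrm{Diff}_{+}^{2}(I)$ such that every non-identity element of $\Gamma$ has at most $N$ fixed points in $(0,1)$. Then $\Gamma$ is metaabelian.
   Context: $I=[0,1]$. $\mathrm{Diff}_{+}^{2}(I)$ denotes the group (under composition) of orientation-preserving $C^2$ diffeomorphisms of $I$. Fixed points are counted in the open interval $(0,1)$. A group is called metaabelian if it is solvable of derived length at most two (so Abelian groups are metaabelian). *)

(* Defs.v *)
From HB Require Import structures.
From mathcomp Require Import all_boot all_order all_algebra.
From mathcomp Require Import all_classical all_reals all_analysis.

Set Implicit Arguments.
Unset Strict Implicit.
Unset Printing Implicit Defensive.

Import Order.TTheory GRing.Theory Num.Theory numFieldNormedType.Exports.

Local Open Scope classical_set_scope.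
Local Open Scope ring_scope.

Section GroupTheory.
Context {G : groupType}.
Implicit Types H K : set G.

Definition subgroup H :=
  [/\ H 1%g, forall x y, H x -> H y -> H (x * y)%g & forall x, H x -> H (x^-1)%g].

Definition commutator_subgroup H K : set G :=
  smallest subgroup [set [~ x, y]%g | x in H & y in K].

Definition derived_series H (n : nat) : set G :=
  iter n (fun K => commutator_subgroup K K) H.

Definition metaabelian H := derived_series H 2 = [set 1%g].

End GroupTheory.

Definition itv01 (R : realType) : set R := `[0, 1]%classic.
Arguments itv01 : clear implicits.

Section UnitInterval.
Context {R : realType}.

(* [itv01 R], used as a type, carries the topology induced by [R], so that the
   limit below is one-sided at 0 and 1. *)
Definition has_deriv (f f' : itv01 R -> R) :=
  forall x, (f y - f x) / (\val y - \val x) @[y --> x^'] --> f' x.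

Definition C2 (f : itv01 R -> R) :=
  exists f1 f2, [/\ has_deriv f f1, has_deriv f1 f2 & continuous f2].

Definition C2_diffeo_pos (f : itv01 R -> itv01 R) :=
  [/\ C2 (\val \o f),
      exists g : itv01 R -> itv01 R,
        [/\ cancel f g, cancel g f & C2 (\val \o g)] &
      forall x y, \val x < \val y -> \val (f x) < \val (f y)].

(* Restatements of [continuousD] and [continuousM] at the type [itv01 R -> R], where
   unification fails to find the library forms. *)
Lemma continuous_add (f g : itv01 R -> R) x :
  {for x, continuous f} -> {for x, continuous g} ->
  {for x, continuous (fun y => f y + g y)}.
Proof. exact: continuousD. Qed.

Lemma continuous_mul (f g : itv01 R -> R) x :
  {for x, continuous f} -> {for x, continuous g} ->
  {for x, continuous (fun y => f y * g y)}.
Proof. exact: continuousM. Qed.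

Lemma has_derivP (f f' : itv01 R -> R) : has_deriv f f' <->
  forall x, exists q : itv01 R -> R, [/\ {for x, continuous q}, q x = f' x &
    forall y, f y - f x = q y * (\val y - \val x)].
Proof.
split=> [df x|df x].
  exists (fun y => if y == x then f' x else (f y - f x) / (\val y - \val x)).
  split=> [||y]; last 2 first.
  - by rewrite eqxx.
  - have [->|yx] := eqVneq y x; first by rewrite !subrr mulr0.
    by rewrite divfK// subr_eq0 (inj_eq val_inj).
  rewrite /prop_for /continuous_at eqxx.
  apply/(@cvgrPdist_lt _ _ _ (nbhs x)) => e e0.
  have /cvgrPdist_lt/(_ e e0) := df x.
  rewrite !near_simpl near_withinE => dq; near=> y.
  have yP : y != x -> `|f' x - (f y - f x) / (\val y - \val x)| < e by near: y.
  by case: ifPn => [_|/yP//]; rewrite subrr normr0.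
have [q [qx <- fq]] := df x.
apply/cvgrPdist_lt => e e0; move/cvgrPdist_lt/(_ e e0) : qx.
rewrite !near_simpl near_withinE => dq; near=> y => yx.
rewrite fq mulfK; last by rewrite subr_eq0 (inj_eq val_inj).
by near: y.
Unshelve. all: by end_near. Qed.

Lemma has_deriv_continuous (f f' : itv01 R -> R) : has_deriv f f' -> continuous f.
Proof.
move=> /has_derivP df x; have [q [qx _ fq]] := df x.
have -> : f = fun y => f x + q y * (\val y - \val x).
  by apply/funext => y; rewrite -fq subrKC.
apply: continuous_add; first exact: cst_continuous.
apply: continuous_mul => //; apply: continuous_add; last exact: cst_continuous.
exact: initial_continuous.
Qed.

Lemma has_deriv_comp (F F' : itv01 R -> R) (g : itv01 R -> itv01 R) g' :
  continuous g -> has_deriv F F' -> has_deriv (\val \o g) g' ->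
  has_deriv (F \o g) (fun x => F' (g x) * g' x).
Proof.
move=> cg /has_derivP dF /has_derivP dg; apply/has_derivP => x.
have [q [qx qE gq]] := dg x; have [p [px pE Fp]] := dF (g x).
exists (fun y => p (g y) * q y); split; last 2 first.
- by rewrite pE qE.
- by move=> y; rewrite /= Fp -mulrA; congr (_ * _); exact: gq.
apply: continuous_mul => //; apply: (@continuous_comp _ _ _ g p) => //; exact: cg.
Qed.

Lemma has_derivM (f f' g g' : itv01 R -> R) :
  has_deriv f f' -> has_deriv g g' ->
  has_deriv (fun x => f x * g x) (fun x => f' x * g x + f x * g' x).
Proof.
move=> df dg; have cf := has_deriv_continuous df.
move: df dg => /has_derivP df /has_derivP dg; apply/has_derivP => x.
have [q [qx qE gq]] := dg x; have [p [px pE fp]] := df x.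
exists (fun y => p y * g x + f y * q y); split; last 2 first.
- by rewrite pE qE.
- move=> y; rewrite mulrDl mulrAC -fp -mulrA -gq.
  by rewrite mulrBl mulrBr [RHS]addrC subrKA.
apply: continuous_add; apply: continuous_mul => //; [exact: cst_continuous|exact: cf].
Qed.

Lemma continuous_valP (g : itv01 R -> itv01 R) :
  continuous (\val \o g) -> continuous g.
Proof. exact: continuous_comp_initial. Qed.

Lemma C2_comp (f g : itv01 R -> itv01 R) :
  C2 (\val \o f) -> C2 (\val \o g) -> C2 (\val \o (f \o g)).
Proof.
move=> [f1 [f2 [df df1 cf2]]] [g1 [g2 [dg dg1 cg2]]].
have cg : continuous g := continuous_valP (has_deriv_continuous dg).
exists (fun x => f1 (g x) * g1 x).
exists (fun x => (f2 (g x) * g1 x) * g1 x + f1 (g x) * g2 x); split.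
- exact: (has_deriv_comp cg df dg).
- by apply: has_derivM => //; exact: (has_deriv_comp cg df1 dg).
have cc h : continuous h -> continuous (fun x => h (g x) : R).
  by move=> ch x; apply: (@continuous_comp _ _ _ g h); [exact: cg|exact: ch].
move=> x; apply: continuous_add; apply: continuous_mul.
- apply: continuous_mul; first exact: cc.
  exact: (has_deriv_continuous dg1).
- exact: (has_deriv_continuous dg1).
- apply: cc; exact: (has_deriv_continuous df1).
- exact: cg2.
Qed.

Lemma C2_id : C2 (\val \o @id (itv01 R)).
Proof.
exists (cst 1), (cst 0); split=> [||x]; last exact: cst_continuous.
- apply/has_derivP => x; exists (cst 1); split => [||y]//=; first exact: cst_continuous.
  by rewrite mul1r.
- apply/has_derivP => x; exists (cst 0); split => [||y]//=; first exact: cst_continuous.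
  by rewrite mul0r subrr.
Qed.

Lemma C2_diffeo_pos_id : C2_diffeo_pos id.
Proof. by split => //; [exact: C2_id|exists id; split => //; exact: C2_id]. Qed.

Lemma C2_diffeo_pos_comp f g :
  C2_diffeo_pos f -> C2_diffeo_pos g -> C2_diffeo_pos (f \o g).
Proof.
move=> [cf [f' [ff' f'f cf']] hf] [cg [g' [gg' g'g cg']] hg]; split.
- exact: C2_comp.
- by exists (g' \o f'); split; [exact: can_comp|exact: can_comp|exact: C2_comp].
- by move=> x y xy; apply/hf/hg.
Qed.

Lemma C2_diffeo_pos_inv f g : C2_diffeo_pos f -> cancel f g -> C2_diffeo_pos g.
Proof.
move=> [cf [f' [ff' f'f cf']] hf] fg.
have -> : g = f' by apply/funext => x; rewrite -{1}(f'f x) fg.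
split => //; first by exists f.
move=> x y xy; rewrite ltNge le_eqVlt; apply/negP => /orP[/eqP e|].
  have {}e : f' y = f' x := val_inj e.
  by move: xy; rewrite -(f'f x) -(f'f y) e ltxx.
by move=> /hf; rewrite !f'f => /(lt_trans xy); rewrite ltxx.
Qed.

End UnitInterval.

Definition Diff2 (R : realType) : Type :=
  set_type [set f : itv01 R -> itv01 R | C2_diffeo_pos f].

Section Diff2Group.
Context {R : realType}.
Implicit Types f g : Diff2 R.

Definition Diff2_fun f : itv01 R -> itv01 R := \val f.
Coercion Diff2_fun : Diff2 >-> Funclass.

Lemma Diff2P f : C2_diffeo_pos f.
Proof. exact: set_mem (valP f). Qed.

Lemma Diff2_ext f g : f =1 g -> f = g.
Proof. by move=> fg; apply/val_inj/funext. Qed.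

Definition mkDiff2 (f : itv01 R -> itv01 R) (fP : C2_diffeo_pos f) : Diff2 R :=
  exist _ f (mem_set fP).

Lemma Diff2_inv_exists f : exists g : Diff2 R, cancel f g /\ cancel g f.
Proof.
have [_ [g [fg gf _]] _] := Diff2P f.
by exists (mkDiff2 (C2_diffeo_pos_inv (Diff2P f) fg)).
Qed.

Definition Diff2_one : Diff2 R := mkDiff2 C2_diffeo_pos_id.

Definition Diff2_mul f g : Diff2 R :=
  mkDiff2 (C2_diffeo_pos_comp (Diff2P f) (Diff2P g)).

Definition Diff2_inv f : Diff2 R := sval (cid (Diff2_inv_exists f)).

Lemma Diff2_mulA : associative Diff2_mul.
Proof. by move=> f g h; apply: Diff2_ext. Qed.

Lemma Diff2_mul1 : left_id Diff2_one Diff2_mul.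
Proof. by move=> f; apply: Diff2_ext. Qed.

Lemma Diff2_mulr1 : right_id Diff2_one Diff2_mul.
Proof. by move=> f; apply: Diff2_ext. Qed.

Lemma Diff2_mulV : left_inverse Diff2_one Diff2_inv Diff2_mul.
Proof.
move=> f; apply: Diff2_ext => x; rewrite /Diff2_inv.
by case: cid => g [/= fg _]; exact: fg.
Qed.

Lemma Diff2_mulrV : right_inverse Diff2_one Diff2_inv Diff2_mul.
Proof.
move=> f; apply: Diff2_ext => x; rewrite /Diff2_inv.
by case: cid => g [/= _ gf]; exact: gf.
Qed.

End Diff2Group.

HB.instance Definition _ (R : realType) := Choice.on (Diff2 R).
HB.instance Definition _ (R : realType) := isGroup.Build (Diff2 R)
  Diff2_mulA Diff2_mul1 Diff2_mulr1 Diff2_mulV Diff2_mulrV.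

Definition fixed_points (R : realType) (f : Diff2 R) : set (itv01 R) :=
  [set x | 0 < \val x < 1 /\ f x = x].

(* Main.v *)
From HB Require Import structures.
Require Import Defs.
From mathcomp Require Import all_boot all_order all_algebra.
From mathcomp Require Import ring lra zify.
From mathcomp Require Import all_classical all_reals all_analysis.
Import Order.TTheory GRing.Theory Num.Theory numFieldNormedType.Exports.

Set Implicit Arguments.
Unset Strict Implicit.
Unset Printing Implicit Defensive.

Local Open Scope classical_set_scope.

(** The order of germs at the endpoint [1] governs everything. A non-identity
    element of the group has finitely many fixed points, so near [1] it lies
    either above or below the identity, and comparing germs turns the group into a
    bi-ordered group. Say that [x] is infinitely small compared with [y], written
    [x ≪ y], if every power of [x] is below [y].

    Regularity enters once, through Kopell's argument. A [C^2] diffeomorphism has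
    bounded distortion, so if [1 < x ≪ c], then the conjugates [x ^ (c ^+ n)]
    converge to the identity at every point of an interval [(r, 1)] on which [c]
    has no fixed point ([kopell_cvg]). In particular [x ^ c < x]
    ([elt_conj_lt]).

    Suppose that there are three Archimedean classes, [1 < a ≪ b ≪ c]. Using only
    the inequality [x ^ c < x], one finds an element [e] and an infinite sequence
    of elements [s i ≪ e] such that [s i.+1] is infinitely small compared with all
    the conjugates [s i ^ (e ^+ n)] ([chain_exists]). Then elements with many fixed
    points can be built one sign change at a time ([alternating_exists]). Let the
    displacement of [u] change sign [m] times on [(r, 1)], and let the germ of [u]
    be comparable with [s i.+1] at most. Inverting [u] if needed, suppose that the
    displacement is negative at the last of the chosen points. For large [n] the map
    [s i ^ (e ^+ n)] is so close to the identity at these points that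
    [u * s i ^ (e ^+ n)] has the same signs there; but near [1] it is
    [s i ^ (e ^+ n)] that dominates, and the product lies above the identity. This
    gives one more sign change. After [N.+1] sign changes the intermediate value
    theorem contradicts the bound on the number of fixed points.

    So there are at most two Archimedean classes. By Hoelder's theorem a commutator
    is infinitely small compared with the larger, in absolute value, of its
    arguments ([infsmall_commg]). If two elements of the derived subgroup did not commute, the
    larger one, [z], would lie in the top class of the group, because their
    commutator fills the class below; then all commutators, hence the whole derived
    subgroup, would be infinitely small compared with [z], and so would [z] itself
    ([metaabelian_rank_le2]). *)

(** * Commutator subgroups *)

Section CommutatorSubgroup.
Context {G : groupType}.
Implicit Types H K : set G.

Lemma subgroup_commutator H K : subgroup (commutator_subgroup H K).
Proof.
split; first by move=> L [[]].
  by move=> x y Dx Dy L LP; have [[_ LM _] _] := LP; apply: LM; [exact: Dx|exact: Dy].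
by move=> x Dx L LP; have [[_ _ LV] _] := LP; apply: LV; exact: Dx.
Qed.

Lemma mem_commutator H K x y : H x -> K y -> commutator_subgroup H K [~ x, y]%g.
Proof. by move=> Hx Ky L [_]; apply; exists x => //; exists y. Qed.

Lemma metaabelian_commg H :
  (forall x y, commutator_subgroup H H x -> commutator_subgroup H H y ->
    [~ x, y]%g = 1%g) ->
  metaabelian H.
Proof.
move=> comm; apply/seteqP; split=> [x|_ ->]; last by move=> K [[]].
apply; split; first split=> //.
- by move=> u v -> ->; rewrite mulg1.
- by move=> u ->; rewrite invg1.
- by move=> _ [u Du [v Dv <-]]; exact: comm.
Qed.

End CommutatorSubgroup.

(** * Bi-ordered groups *)

HB.mixin Record isBiOrdered d G of Group G & Order.Total d G := {
  ltgM2lW : forall z x y : G, (x < y)%O -> (z * x < z * y)%g%O;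
  ltgM2rW : forall z x y : G, (x < y)%O -> (x * z < y * z)%g%O }.

#[short(type="biOrderedGroupType")]
HB.structure Definition BiOrderedGroup d :=
  {G of isBiOrdered d G & Group G & Order.Total d G}.

Section BiOrderedGroupTheory.
Context {d : Order.disp_t} {G : biOrderedGroupType d}.
Implicit Types a b c e p q w x y z : G.
Local Open Scope group_scope.
Local Open Scope order_scope.

Lemma ltgM2l z : {mono *%g z : x y / x < y}.
Proof. by apply: leW_mono; apply: le_mono; exact: ltgM2lW. Qed.

Lemma ltgM2r z : {mono *%g^~ z : x y / x < y}.
Proof. by apply: leW_mono; apply: le_mono; exact: ltgM2rW. Qed.

Lemma legM2l z : {mono *%g z : x y / x <= y}.
Proof. by apply: le_mono; exact: ltgM2lW. Qed.

Lemma legM2r z : {mono *%g^~ z : x y / x <= y}.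
Proof. by apply: le_mono; exact: ltgM2rW. Qed.

Lemma legM x y z w : x <= y -> z <= w -> x * z <= y * w.
Proof. by move=> xy zw; rewrite (le_trans (_ : _ <= y * z)) ?legM2l ?legM2r. Qed.

Lemma ltgV1 x : (x^-1 < 1) = (1 < x).
Proof. by rewrite -(ltgM2l x) mulgV mulg1. Qed.

Lemma lt1gV x : (1 < x^-1) = (x < 1).
Proof. by rewrite -(ltgM2l x) mulgV mulg1. Qed.

Lemma legV x y : (x^-1 <= y^-1) = (y <= x).
Proof. by rewrite -(legM2l x) mulgV -(legM2r y) mulgVK mul1g. Qed.

Lemma ltgJ z : {mono conjg^~ z : x y / x < y}.
Proof. by move=> x y; rewrite /conjg ltgM2l ltgM2r. Qed.

Lemma legJ z : {mono conjg^~ z : x y / x <= y}.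
Proof. by move=> x y; rewrite /conjg legM2l legM2r. Qed.

Lemma legX n x y : x <= y -> x ^+ n <= y ^+ n.
Proof. by move=> xy; elim: n => // n IH; rewrite !expgS legM. Qed.

Lemma ltgX n x y : (0 < n)%N -> x < y -> x ^+ n < y ^+ n.
Proof.
case: n => // n _ xy; rewrite !expgS (le_lt_trans (_ : _ <= x * y ^+ n)) //.
  by rewrite legM2l legX// ltW.
by rewrite ltgM2r.
Qed.

Lemma ltgX2 n x y : (0 < n)%N -> (x ^+ n < y ^+ n) = (x < y).
Proof.
move=> n0; apply/idP/idP => [|/ltgX->//].
by apply: contraTT; rewrite -!leNgt; exact: legX.
Qed.

Lemma expg_ge1 n x : 1 <= x -> 1 <= x ^+ n.
Proof. by move=> /(legX n); rewrite expg1n. Qed.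

Lemma legX_homo x m n : 1 <= x -> (m <= n)%N -> x ^+ m <= x ^+ n.
Proof.
by move=> x1 /subnKC <-; rewrite expgnDr -[leLHS]mulg1 legM2l expg_ge1.
Qed.

Lemma ltgX_homo x m n : 1 < x -> (m < n)%N -> x ^+ m < x ^+ n.
Proof.
move=> x1 /(legX_homo (ltW x1)); apply: lt_le_trans.
by rewrite expgSr -[ltLHS]mulg1 ltgM2l.
Qed.

Lemma ltgX_mono x m n : 1 < x -> (x ^+ m < x ^+ n) = (m < n)%N.
Proof.
move=> x1; apply/idP/idP => [|/ltgX_homo->//].
by apply: contraTT; rewrite -leNgt -leqNgt => /legX_homo->//; exact: ltW.
Qed.

Lemma legX_mono x m n : 1 < x -> (x ^+ m <= x ^+ n) = (m <= n)%N.
Proof. by move=> x1; rewrite leNgt ltgX_mono// -leqNgt. Qed.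

(** [q] and [y] need not commute, but one of [q * y] and [y * q] is the smaller,
    and sorting the letters of the word [(q * y) ^+ k] in that order can only
    decrease it. As [z] and [w] commute, it does not matter which of the two sorted
    words is obtained. *)
Lemma leg_expMn k q y z w : commute z w -> z <= q ^+ k -> w <= y ^+ k ->
  z * w <= (q * y) ^+ k.
Proof.
move=> zw zq wy; have [qy|/ltW qy] := leP (q * y) (y * q).
  have qy' j : q ^+ j * y <= y * q ^+ j.
    elim: j => [|j IH]; first by rewrite mulg1 mul1g.
    rewrite expgS -mulgA (le_trans (_ : _ <= q * (y * q ^+ j))) ?legM2l//.
    by rewrite !mulgA legM2r.
  apply: (le_trans (legM zq wy)); elim: k {zq wy} => [|k IH].
    by rewrite mulg1.
  rewrite [in leRHS]expgS (le_trans _ (legM (lexx _) IH))//.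
  rewrite [in leLHS]expgS [y ^+ _]expgS -!mulgA legM2l !mulgA legM2r.
  exact: qy'.
have qy' j : y * q ^+ j <= q ^+ j * y.
  elim: j => [|j IH]; first by rewrite mulg1 mul1g.
  rewrite expgSr mulgA (le_trans (_ : _ <= q ^+ j * y * q)) ?legM2r//.
  by rewrite -!mulgA legM2l.
rewrite zw; apply: (le_trans (legM wy zq)); elim: k {zq wy} => [|k IH].
  by rewrite mulg1.
rewrite [in leRHS]expgSr (le_trans _ (legM IH (lexx _)))//.
rewrite [in leLHS]expgSr -!mulgA legM2l [in leRHS]mulgA -expgSr.
exact: qy'.
Qed.

Lemma leg_expMn_ub k q y z w : commute z w -> q ^+ k <= z -> y ^+ k <= w ->
  (q * y) ^+ k <= z * w.
Proof.
move=> zw qz yw; rewrite -legV -expVgn !invgM.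
apply: leg_expMn; rewrite ?expVgn ?legV//.
by apply/commuteV/commute_sym/commuteV.
Qed.

Definition infsmall x y := forall n, x ^+ n < y.
Local Notation "x ≪ y" := (infsmall x y) (at level 70).

Lemma infsmall_gt1 x y : x ≪ y -> 1 < y.
Proof. by move=> /(_ 0). Qed.

Lemma infsmall_lt x y : x ≪ y -> x < y.
Proof. by move=> /(_ 1%N). Qed.

Lemma infsmallX k x y : x ≪ y -> x ^+ k ≪ y.
Proof. by move=> xy n; rewrite -expgnA. Qed.

Lemma infsmall_root k x y : x ≪ y ^+ k -> x ≪ y.
Proof.
move=> xy; have k0 : (0 < k)%N by case: k xy => // /infsmall_gt1; rewrite ltxx.
by move=> n; rewrite -(ltgX2 _ _ k0) -expgnA.
Qed.

Lemma le_infsmall x y z : x <= y -> y ≪ z -> x ≪ z.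
Proof. by move=> xy yz n; rewrite (le_lt_trans (legX n xy)). Qed.

Lemma infsmall_le x y z : x ≪ y -> y <= z -> x ≪ z.
Proof. by move=> xy yz n; rewrite (lt_le_trans (xy n)). Qed.

Lemma infsmall_trans x y z : x ≪ y -> y ≪ z -> x ≪ z.
Proof. by move=> xy /infsmall_lt/ltW; exact: infsmall_le. Qed.

Lemma infsmallJ z x y : x ≪ y -> x ^ z ≪ y ^ z.
Proof. by move=> xy n; rewrite -conjXg ltgJ. Qed.

Lemma infsmall_mul x y z : x ≪ z -> y ≪ z -> x * y ≪ z.
Proof.
move=> xz yz; have [xy|/ltW xy] := leP x y.
  by apply: le_infsmall (infsmallX 2 yz); rewrite legM2r.
by apply: le_infsmall (infsmallX 2 xz); rewrite legM2l.
Qed.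

(** * Commutators in bi-ordered groups *)

(** The power of [z] just below [x]. Its exponent may be negative, so what is kept
    of it is that it commutes with whatever commutes with [z]. *)
Lemma floor_power x z n : 1 < z -> x <= z ^+ n -> x^-1 <= z ^+ n ->
  exists2 w, (forall u, commute u z -> commute u w) & w <= x < w * z.
Proof.
move=> z1 xz Vxz; pose t := z ^+ n * x.
(* Shifting by [z ^+ n] makes the exponent a natural number. *)
have ex : exists i, z ^+ i <= t.
  by exists 0; rewrite /t -(legM2r x^-1) mul1g mulgK.
have bnd i : z ^+ i <= t -> (i <= n + n)%N.
  move=> /le_trans/(_ (_ : t <= z ^+ (n + n))); rewrite expgnDr legM2l.
  by move=> /(_ xz); rewrite -expgnDr leNgt ltgX_mono// -leqNgt.
case: (ex_maxnP ex bnd) => i it imax; exists (z ^- n * z ^+ i).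
  by move=> u uz; apply: commuteM; [apply: commuteV|]; apply: commuteX.
rewrite -(legM2l (z ^+ n)) -(ltgM2l (z ^+ n)) !mulgA mulgV mul1g it/= -expgSr.
by rewrite ltNge; apply/negP => /imax; rewrite ltnn.
Qed.

(** If all powers of [x] and [y] agree up to a bounded power of [z], then [x] and
    [y] agree up to an infinitely small factor: a factor whose [m]-th power
    exceeds [z] would produce a discrepancy [z ^+ 3] between [3 * m]-th powers. *)
Lemma infsmall_div x y z : 1 < z ->
  (forall k, exists w, [/\ commute z w, w <= y ^+ k & x ^+ k <= w * z ^+ 2]) ->
  y^-1 * x ≪ z.
Proof.
move=> z1 xy m; rewrite ltNge; apply/negP => zq.
have [w [zw wy xw]] := xy (m * 3)%N.
have zq3 : z ^+ 3 <= (y^-1 * x) ^+ (m * 3) by rewrite expgnA legX.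
have wz3 : commute w (z ^+ 3) by apply/commuteX/commute_sym.
have := leg_expMn wz3 wy zq3; rewrite mulVKg => /le_trans/(_ xw).
by rewrite legM2l leNgt ltgX_mono.
Qed.

(** Hoelder's argument. Let [u] and [v] be the powers of [z] just below [x ^+ k] and
    [y ^+ k]. Then both [(x * y) ^+ k] and [(y * x) ^+ k] lie between [u * v] and
    [u * v * z ^+ 2], whatever [k] is, so [x * y] and [y * x] differ by an
    infinitely small factor. *)
Lemma infsmall_commg x y z n : 1 < z ->
  x <= z ^+ n -> x^-1 <= z ^+ n -> y <= z ^+ n -> y^-1 <= z ^+ n ->
  [~ x, y] ≪ z.
Proof.
move=> z1 xz Vxz yz Vyz; have -> : [~ x, y] = (y * x)^-1 * (x * y).
  by rewrite /commg /conjg invgM !mulgA.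
apply: infsmall_div => // k.
have [||u zu /andP[ux xu]] := @floor_power (x ^+ k) z (n * k) z1.
- by rewrite expgnA legX.
- by rewrite -expVgn expgnA legX.
have [||v zv /andP[vy yv]] := @floor_power (y ^+ k) z (n * k) z1.
- by rewrite expgnA legX.
- by rewrite -expVgn expgnA legX.
have vu : commute v u by apply/zu/commute_sym/zv.
exists (u * v); split; first by apply: commuteM; [exact: zu|exact: zv].
  by rewrite -vu; exact: leg_expMn.
apply: (le_trans (leg_expMn_ub _ (ltW xu) (ltW yv))).
  have zuz : commute z (u * z) by apply: commuteM => //; exact: zu.
  apply: commuteM; last exact: commute_sym.
  apply/commute_sym/commuteM; first exact: vu.
  exact/commute_sym/zv.
by rewrite -!mulgA legM2l !mulgA (zv z).
Qed.

(** With at most two Archimedean classes, the commutator of two elements of the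
    derived subgroup [D] is trivial: otherwise the larger element [z] is in the top
    class, so that every commutator of the group is infinitely small compared with
    [z], and hence so is every element of [D], including [z]. *)
Lemma metaabelian_rank_le2 :
  (forall a b c, 1 < a -> a ≪ b -> b ≪ c -> False) -> metaabelian [set: G].
Proof.
move=> rank2; pose abs x := Order.max x x^-1.
pose D := commutator_subgroup [set: G] [set: G].
have [_ _ DV] : subgroup D by exact: subgroup_commutator.
have Dabs x : D x -> D (abs x) by move=> Dx; rewrite /abs; case: ltP => _ //; exact: DV.
have abs_gt1 x : x != 1 -> 1 < abs x.
  rewrite /abs lt_max lt1gV; by case: ltgtP.
have leabs x : x <= abs x /\ x^-1 <= abs x by rewrite /abs !le_max !lexx orbT.
apply: metaabelian_commg => p q Dp Dq; apply/eqP/negPn/negP => pq1.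
pose z := Order.max (abs p) (abs q).
have Dz : D z by rewrite /z; case: ltP => _; exact: Dabs.
have [[pp Vp] [qq Vq]] := (leabs p, leabs q).
have p1 : p != 1 by apply: contraNneq pq1 => ->; rewrite comm1g.
have z1 : 1 < z by rewrite lt_max abs_gt1.
have [rz Vrz] : [~ p, q] ≪ z /\ [~ q, p] ≪ z.
  by split; apply: (@infsmall_commg _ _ z 1 z1); rewrite expg1 le_max ?pp ?Vp ?qq ?Vq ?orbT.
have absrz : abs [~ p, q] ≪ z by rewrite /abs invgR; case: ltP.
have arch x : exists n, abs x <= z ^+ n.
  apply: contrapT => nx; apply: (rank2 _ _ (abs x) (abs_gt1 _ pq1) absrz) => n.
  by rewrite ltNge; apply/negP => xn; apply: nx; exists n.
pose K : set G := [set x | x ≪ z /\ x^-1 ≪ z].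
have [/infsmall_lt] : K z; last by rewrite ltxx.
  apply: (Dz K); split; first split.
  - by split=> n; rewrite ?invg1 expg1n.
  - by move=> x y [xz Vxz] [yz Vyz]; split; rewrite ?invgM; exact: infsmall_mul.
  - by move=> x [xz Vxz]; split; rewrite ?invgK.
  - have cz x y : [~ x, y] ≪ z.
      have [[n xn] [m ym]] := (arch x, arch y).
      have zn k : (k <= n + m)%N -> z ^+ k <= z ^+ (n + m).
        by apply: legX_homo; exact: ltW.
      have [[xx Vx] [yy Vy]] := (leabs x, leabs y).
      have {}xn := le_trans xn (zn _ (leq_addr _ _)).
      have {}ym := le_trans ym (zn _ (leq_addl _ _)).
      apply: (@infsmall_commg _ _ _ (n + m) z1).
      + exact: le_trans xn.
      + exact: le_trans xn.
      + exact: le_trans ym.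
      + exact: le_trans ym.
    by move=> _ [x _ [y _ <-]]; split; rewrite ?invgR; exact: cz.
Qed.

(** * Infinite chains of infinitesimals *)

Section Chain.
(** For germs of diffeomorphisms this is the content of Kopell's lemma. *)
Context (conj_lt : forall c x, 1 < x -> x ≪ c -> x ^ c < x).

Lemma conjX_le c x n : 1 < x -> x ≪ c -> x ^ (c ^+ n) <= x.
Proof.
move=> x1 xc; elim: n => [|n IH]; first by rewrite conjg1.
by rewrite expgS conjgM (le_trans _ IH)// legJ ltW// conj_lt.
Qed.

Lemma infsmall_divX x y c n : y ≪ x -> x ≪ c -> y ≪ x ^- n * c.
Proof.
move=> yx xc m; rewrite -(ltgM2l (x ^+ n)) mulVKg (lt_trans _ (xc n.+1))//.
by rewrite expgSr ltgM2l.
Qed.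

Lemma gt1J x y : (1 < x ^ y) = (1 < x).
Proof. by rewrite -[RHS](ltgJ y) conj1g. Qed.

(** First case: conjugation by [c] lowers the class of [x]. Then the conjugates
    [X i := x ^ (c ^+ i)] form a decreasing sequence of classes, and [x] itself can
    serve as the conjugating element for the later terms: every [x ^- n * c] still
    dominates, and it conjugates [X i ^ (x ^+ n)] to [X i.+1]; hence
    [X i.+1 < X i ^ (x ^+ n)]. Taking every other term turns this inequality into
    [X i.+2 ≪ X i ^ (x ^+ n)]. *)
Lemma chain_of_drop c x : 1 < x -> x ≪ c -> x ^ c ≪ x ->
  exists s : nat -> G, [/\ forall i, 1 < s i, forall i, s i ≪ x &
    forall i n, s i.+1 ≪ s i ^ (x ^+ n)].
Proof.
move=> x1 xc dropx; pose X i := x ^ (c ^+ i).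
have X1 i : 1 < X i by rewrite gt1J.
have XS i : X i ^ c = X i.+1 by rewrite /X expgSr conjgM.
have Xdrop i : X i.+1 ≪ X i by rewrite /X expgS conjgM; exact: infsmallJ.
have Xx i : X i.+1 ≪ x.
  elim: i => [|i IH]; last exact: infsmall_trans (Xdrop _) IH.
  by have := Xdrop 0%N; rewrite {2}/X conjg1.
(* The terms start at [X 1] because [X 0 = x] is not below [x]. *)
exists (fun i => X i.*2.+1); split=> // i n; rewrite doubleS.
apply: infsmall_le (Xdrop _) (ltW _); rewrite -XS.
have -> : X i.*2.+1 ^ c = (X i.*2.+1 ^ (x ^+ n)) ^ (x ^- n * c).
  by rewrite -[RHS]conjgM mulVKg.
apply: conj_lt; first by rewrite gt1J.
apply: le_infsmall (infsmall_divX n (Xx _) xc); exact: conjX_le.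
Qed.

Lemma ltn_expn_mul k K : exists j, (k ^ j * K < k.+1 ^ j)%N.
Proof.
have bernoulli j : (k ^ j * (k + j) <= k * k.+1 ^ j)%N.
  elim: j => [|j IH]; first by rewrite !expn0 mul1n muln1 addn0.
  rewrite !expnSr mulnA (leq_trans _ (leq_mul IH (leqnn k.+1)))//.
  by rewrite -!mulnA leq_mul2l mulnS mulnC; apply/orP; right; lia.
case: k bernoulli => [_|k bernoulli]; first by exists 1%N.
exists (k.+1 * K)%N; have := bernoulli (k.+1 * K)%N.
by rewrite -mulnS mulnCA leq_mul2l /= mulnS; apply: leq_trans; rewrite -add1n leq_add2r expn_gt0.
Qed.

(** If conjugation by [c] does not lower the class of [y], and [a ≪ c], then
    conjugation by [a] does not even change [y] to first order. Indeed, if [a]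
    contracted [y ^+ k.+1] below [y ^+ k], then the power [a ^+ j], which is still
    dominated by [c], would contract by the factor [(k / k.+1) ^ j]; for large [j]
    this is less than [K^-1], whereas [c] contracts [y] by at most the factor
    [K^-1]. *)
Lemma div_conj_infsmall a c y K : 1 < y -> y ≪ a -> a ≪ c -> y <= (y ^ c) ^+ K ->
  (y ^ a)^-1 * y ≪ y.
Proof.
move=> y1 ya ac nodrop; apply: infsmall_div => //.
have conj_lb k : y ^+ k <= (y ^ a) ^+ k.+1.
  rewrite leNgt; apply/negP => lty.
  have [j] := ltn_expn_mul k K; apply/negP; rewrite -leqNgt -(legX_mono _ _ y1).
  have iter_lty : (y ^+ (k.+1 ^ j)) ^ (a ^+ j) <= y ^+ (k ^ j).
    elim: j => [|j IH]; first by rewrite conjg1.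
    rewrite expgSr conjgM expnSr expgnA; move: (y ^+ (k.+1 ^ j)) IH => Y IH.
    rewrite !conjXg (le_trans (_ : _ <= ((y ^ a) ^+ (k ^ j)) ^+ k.+1)) ?legX//.
      by rewrite -conjXg legJ.
    by rewrite expgnAC expnS expgnA legX// ltW.
  have -> : y ^+ (k ^ j * K) = (y ^+ (k ^ j)) ^+ K by rewrite expgnA.
  rewrite (le_trans (legX _ nodrop))// -expgnA mulnC expgnA legX//.
  have -> : (y ^ c) ^+ (k.+1 ^ j) = ((y ^+ (k.+1 ^ j)) ^ (a ^+ j)) ^ (a ^- j * c).
    by rewrite -[RHS]conjgM mulVKg conjXg.
  rewrite (le_trans (_ : _ <= (y ^+ (k ^ j)) ^ (a ^- j * c))) ?legJ//.
  by rewrite conjXg legX// ltW// conj_lt//; exact: infsmall_divX.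
case=> [|k].
  exists 1; split=> //; first exact: commute1.
  by rewrite mul1g; exact/expg_ge1/ltW.
exists (y ^+ k); split => //; first exact: commuteX.
by rewrite -expgnDr addn2 legX_homo// ltW.
Qed.

(** Second case: conjugation by [c] lowers no class. Iterated commutators with [a]
    provide the decreasing sequence of classes, and conjugation by [c ^+ n] leaves
    these classes unchanged. *)
Lemma chain_of_nodrop a c h : 1 < h -> h ≪ a -> a ≪ c ->
  (forall y, 1 < y -> y ≪ c -> exists K, y <= (y ^ c) ^+ K) ->
  exists s : nat -> G, [/\ forall i, 1 < s i, forall i, s i ≪ c &
    forall i n, s i.+1 ≪ s i ^ (c ^+ n)].
Proof.
move=> h1 ha ac nodrop; pose s i := iter i (fun y => (y ^ a)^-1 * y) h.
have sP i : 1 < s i /\ s i ≪ a.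
  elim: i => [//|i [si1 sia]]; rewrite /s iterS -/(s i); split.
    by rewrite -(ltgM2l (s i ^ a)) mulg1 mulVKg conj_lt.
  have [K sK] := nodrop _ si1 (infsmall_trans sia ac).
  exact: infsmall_trans (div_conj_infsmall si1 sia ac sK) sia.
exists s; split=> [i|i|i n]; first exact: (sP i).1.
  exact: infsmall_trans (sP i).2 ac.
have [si1 sia] := sP i; have sic := infsmall_trans sia ac.
have [K sK] : exists K, s i <= (s i ^ (c ^+ n)) ^+ K.
  elim: n => [|n [K sK]]; first by exists 1%N; rewrite conjg1.
  have cc : c ^ (c ^+ n) = c.
    by apply/conjg_fixP/eqP; rewrite commgXg.
  have [||L sL] := nodrop (s i ^ (c ^+ n)); first by rewrite gt1J.
    by rewrite -{2}cc; exact: infsmallJ.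
  exists (L * K)%N; rewrite expgnA expgSr conjgM (le_trans sK)//; exact: legX.
apply: (@infsmall_root K); have [L sL] := nodrop _ si1 sic.
exact: infsmall_le (div_conj_infsmall si1 sia ac sL) sK.
Qed.

Lemma chain_exists a b c : 1 < a -> a ≪ b -> b ≪ c ->
  exists e (s : nat -> G), [/\ forall i, 1 < s i, forall i, s i ≪ e &
    forall i n, s i.+1 ≪ s i ^ (e ^+ n)].
Proof.
move=> a1 ab bc; have [drop|nodrop] := pselect (exists x, [/\ 1 < x, x ≪ c & x ^ c ≪ x]).
  by have [x [x1 xc xcx]] := drop; exists x; exact: chain_of_drop xcx.
exists c; apply: chain_of_nodrop a1 ab bc _ => y y1 yc.
apply: contrapT => noK; apply: nodrop; exists y; split=> // n.
by rewrite ltNge; apply/negP => yK; apply: noK; exists n.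
Qed.

End Chain.
End BiOrderedGroupTheory.

Local Open Scope ring_scope.

(** * Calculus on the unit interval *)

Section Calculus.
Context {R : realType}.
Implicit Types (s t : R) (x y : itv01 R) (h : itv01 R -> R).

(** Functions on [itv01 R] are transported to the real line through the retraction
    [pt], where the mean and extreme value theorems are available. *)
Definition clamp t : R := Num.max 0 (Num.min t 1).

Lemma clamp_itv t : itv01 R (clamp t).
Proof.
by rewrite /itv01 /= in_itv/= le_max lexx/= ge_max ler01 ge_min lexx orbT.
Qed.

Definition pt t : itv01 R := exist _ (clamp t) (mem_set (clamp_itv t)).

Lemma val_pt t : 0 <= t <= 1 -> \val (pt t) = t.
Proof. by move=> /andP[t0 t1]; rewrite /= /clamp min_l// max_r. Qed.

Lemma val_itv01 x : 0 <= \val x <= 1.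
Proof. by have := set_mem (valP x); rewrite /itv01 /= in_itv. Qed.

Lemma valK_pt : cancel \val pt.
Proof. by move=> x; apply/val_inj; rewrite val_pt// val_itv01. Qed.

Lemma pt_continuous : continuous pt.
Proof.
apply: continuous_comp_initial => t.
apply: (@continuous_max R R (cst 0) (fun u => Num.min u 1)).
  exact: cst_continuous.
by apply: (@continuous_min R R id (cst 1)); [exact: cvg_id|exact: cst_continuous].
Qed.

Lemma MVT_itv01 h h' s t : has_deriv h h' -> 0 <= s -> s < t -> t <= 1 ->
  exists2 x, s <= \val x <= t & h (pt t) - h (pt s) = h' x * (t - s).
Proof.
move=> dh s0 st t1.
have ch : continuous (h \o pt).
  move=> u; apply: continuous_comp; first exact: pt_continuous.
  exact: (has_deriv_continuous dh).
have [||c + ->] := @MVT _ (h \o pt) (h' \o pt) s t st.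
- move=> u; rewrite in_itv/= => /andP[su ut].
  apply/is_derive1_caratheodory.
  have [q [qc qE hq]] := (has_derivP h h').1 dh (pt u).
  have u01 : 0 < u < 1 by apply/andP; split; lra.
  (* The slope is prescribed only inside the interval; the value given outside
     makes the Caratheodory identity hold everywhere. *)
  exists (fun z => if 0 <= z <= 1 then q (pt z) else (h (pt z) - h (pt u)) / (z - u)).
  split.
  + move=> z /=; case: ifPn => z01; last first.
      by rewrite divfK// subr_eq0; apply: contraNneq z01 => ->; lra.
    by rewrite hq !val_pt//; lra.
  + rewrite /prop_for /continuous_at.
    rewrite ifT; last by lra.
    apply: (@cvg_trans _ (q (pt z) @[z --> u])); last first.
      by apply: (@continuous_comp _ _ _ pt q); [exact: pt_continuous|exact: qc].
    apply: near_eq_cvg; near=> z.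
    suff -> : 0 <= z <= 1 by [].
    have : 0 < z < 1 by near: z; apply: near_in_itvoo; rewrite in_itv/=.
    lra.
  + by rewrite ifT /= ?qE//; lra.
- exact: continuous_subspaceT.
rewrite in_itv/= => /andP[sc ct]; exists (pt c) => //.
by rewrite val_pt; lra.
Unshelve. all: by end_near. Qed.

Lemma bounded_itv01 h : continuous h -> exists2 B, 0 <= B & forall x, `|h x| <= B.
Proof.
move=> ch; have chp : {within `[0, 1], continuous (h \o pt)}.
  apply: continuous_subspaceT => u; apply: continuous_comp; first exact: pt_continuous.
  exact: ch.
have [u _ hu] := EVT_max ler01 chp; have [v _ hv] := EVT_min ler01 chp.
exists (`|h (pt u)| + `|h (pt v)|) => [|x]; first by rewrite addr_ge0.
have := hu (\val x); have := hv (\val x); rewrite in_itv/= val_itv01 valK_pt.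
move=> /(_ isT) hvx /(_ isT) hxu; rewrite ler_norml.
have := ler_norm (h (pt u)); have := ler_norm (- h (pt v)); rewrite normrN.
have := normr_ge0 (h (pt u)); have := normr_ge0 (h (pt v)); lra.
Qed.

End Calculus.

(** * Diffeomorphisms as real functions *)

Section Action.
Context {R : realType}.
Implicit Types (s t p q : R) (x y : itv01 R) (c f g : Diff2 R).

Definition act f t : R := \val (f (pt t)).

Lemma act_itv f t : 0 <= act f t <= 1.
Proof. exact: val_itv01. Qed.

Lemma act1 t : 0 <= t <= 1 -> act 1%g t = t.
Proof. exact: val_pt. Qed.

Lemma actM f g t : act (f * g)%g t = act f (act g t).
Proof. by rewrite /act valK_pt. Qed.

Lemma actK f t : 0 <= t <= 1 -> act f^-1%g (act f t) = t.
Proof. by move=> t01; rewrite -actM mulVg act1. Qed.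

Lemma actVK f t : 0 <= t <= 1 -> act f (act f^-1%g t) = t.
Proof. by move=> t01; rewrite -actM mulgV act1. Qed.

Lemma act_lt f s t : 0 <= s -> s < t -> t <= 1 -> act f s < act f t.
Proof.
by move=> s0 st t1; have [_ _] := Diff2P f; apply; rewrite !val_pt//; lra.
Qed.

Lemma act_le f s t : 0 <= s -> s <= t -> t <= 1 -> act f s <= act f t.
Proof.
by move=> s0; rewrite le_eqVlt => /predU1P[->//|st] t1; exact/ltW/act_lt.
Qed.

Lemma act_at1 f : act f 1 = 1.
Proof.
have h : 0 <= (1 : R) <= 1 by lra.
have := act_itv f 1; have /andP[a0 a1] := act_itv f^-1%g 1.
have := act_le f a0 a1 (lexx 1); rewrite actVK//; lra.
Qed.

Lemma act_at0 f : act f 0 = 0.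
Proof.
have h : 0 <= (0 : R) <= 1 by lra.
have := act_itv f 0; have /andP[a0 a1] := act_itv f^-1%g 0.
have := act_le f (lexx 0) a0 a1; rewrite actVK//; lra.
Qed.

Lemma act_itvoo f t : 0 < t < 1 -> 0 < act f t < 1.
Proof.
move=> t01; have := act_lt f (lexx 0) (_ : 0 < t) (_ : t <= 1).
have := act_lt f (_ : 0 <= t) (_ : t < 1) (lexx 1); rewrite act_at1.
by have := act_itv f 0; lra.
Qed.

Lemma act_continuous f : continuous (act f).
Proof.
have [[f1 [_ [df _ _]]] _ _] := Diff2P f.
move=> t; apply: (@continuous_comp _ _ _ pt (\val \o f)).
  exact: pt_continuous.
exact: (has_deriv_continuous df).
Qed.

(** The slopes of [c] over two subintervals of [[p, q]] are derivatives of [c] at two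
    points of [[p, q]]; these differ by at most [B2 * (q - p)] since the second
    derivative is bounded by [B2], and they are bounded below by [B1^-1] since the
    inverse of [c] is [B1]-Lipschitz. *)
Lemma bounded_distortion c : exists2 L, 0 <= L &
  forall p q s1 t1 s2 t2, 0 <= p -> q <= 1 ->
    p <= s1 -> s1 < t1 -> t1 <= q -> p <= s2 -> s2 < t2 -> t2 <= q ->
  (act c t1 - act c s1) * (t2 - s2) <=
    (1 + L * (q - p)) * ((act c t2 - act c s2) * (t1 - s1)).
Proof.
have [[c1 [c2 [dc dc1 cc2]]] _ _] := Diff2P c.
have [[g1 [g2 [dg dg1 _]]] _ _] := Diff2P c^-1%g.
have [B1 B10 g1B] := bounded_itv01 (has_deriv_continuous dg1).
have [B2 B20 c2B] := bounded_itv01 cc2.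
exists (B2 * B1) => [|p q s1 t1 s2 t2 p0 q1 ps1 st1 t1q ps2 st2 t2q].
  exact: mulr_ge0.
have [||x1 x1P E1] := MVT_itv01 dc _ st1; [lra..|].
have [||x2 x2P E2] := MVT_itv01 dc _ st2; [lra..|].
have lip x y : \val y < \val x -> `|c1 x - c1 y| <= B2 * (\val x - \val y).
  move=> yx; have := val_itv01 x; have := val_itv01 y => yP xP.
  have [||z _] := MVT_itv01 dc1 _ yx; [lra..|].
  by rewrite !valK_pt => ->; rewrite normrM ler_pM// ger0_norm//; lra.
have c1x : c1 x1 - c1 x2 <= B2 * (q - p).
  apply: (le_trans (ler_norm _)); have [x12|x12|/val_inj ->] := ltgtP (\val x1) (\val x2).
  - by rewrite distrC (le_trans (lip _ _ x12))// ler_wpM2l//; lra.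
  - by rewrite (le_trans (lip _ _ x12))// ler_wpM2l//; lra.
  - by rewrite subrr normr0 mulr_ge0//; lra.
have cst2 := act_lt c (_ : 0 <= s2) st2 (_ : t2 <= 1).
have expand : t2 - s2 <= B1 * (act c t2 - act c s2).
  have := act_itv c s2; have := act_itv c t2 => ct2 cs2.
  have {}cst2 : act c s2 < act c t2 by apply: cst2; lra.
  have [||z _ Eg] := MVT_itv01 dg _ cst2; [lra..|].
  have -> : t2 - s2 = g1 z * (act c t2 - act c s2).
    by transitivity (act c^-1%g (act c t2) - act c^-1%g (act c s2)); [rewrite !actK; lra|exact: Eg].
  rewrite ler_wpM2r//; first by lra.
  exact: le_trans (ler_norm _) (g1B z).
rewrite /act in cst2 expand *; rewrite /= in E1 E2; rewrite E1 {}E2 in expand cst2 *.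
set I := t1 - s1; set J := t2 - s2 in expand *.
have I0 : 0 < I by rewrite subr_gt0.
have J0 : 0 < J by rewrite subr_gt0.
have : (c1 x1 - c1 x2) * (I * J) <= B2 * (q - p) * (I * J).
  by rewrite ler_wpM2r// mulr_ge0// ltW.
have : B2 * (q - p) * I * J <= B2 * (q - p) * I * (B1 * (c1 x2 * J)).
  by rewrite ler_wpM2l// !mulr_ge0//; lra.
nra.
Qed.

End Action.

(** * Kopell's convergence *)

Section Kopell.
Context {R : realType}.
Implicit Types (s t p q r y z : R) (c x f g : Diff2 R).

Definition lt_on r f g := forall t, r < t < 1 -> act f t < act g t.

Definition germ_lt f g := exists2 r, 0 <= r < 1 & lt_on r f g.

(** An infinitely small [x] is tangent to the identity at [1]. By bounded distortion
    it is enough to bound below the slope of [x] over [[p, 1]], which is the content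
    of [slope1]: if it were smaller than [1] by a definite factor, then the powers
    of [x] would attract to [1] at exponential rates growing without bound, and [c],
    which moves points to [1] even faster than all of them, would have derivative
    [0] at [1]. *)
Lemma slope_near1 x c (e : R) : (forall n, germ_lt (x ^+ n)%g c) -> 0 < e ->
  exists2 r, 0 <= r < 1 & forall s t, r <= s -> s < t -> t <= 1 ->
    (1 - e) * (t - s) <= act x t - act x s.
Proof.
move=> xc e0; have [L L0 dist] := bounded_distortion x.
have [K K0 distc] := bounded_distortion c.
have slope1 p : 0 < p < 1 -> 1 - p <= (1 + L * (1 - p)) * (1 - act x p).
  move=> p01; rewrite leNgt; apply/negP => ltp.
  pose m := (1 + L * (1 - p)) * (1 - act x p) / (1 - p).
  have xp := act_itvoo x p01.
  have Lp : 0 <= L * (1 - p) by rewrite mulr_ge0//; lra.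
  have m0 : 0 <= m.
    by rewrite /m divr_ge0// ?mulr_ge0//; lra.
  have m1 : m < 1 by rewrite /m ltr_pdivrMr; lra.
  have step z : p <= z < 1 -> 1 - act x z <= m * (1 - z).
    move=> zp; rewrite /m mulrAC ler_pdivlMr; last by lra.
    have : (act x 1 - act x z) * (1 - p) <=
        (1 + L * (1 - p)) * ((act x 1 - act x p) * (1 - z)) by apply: dist; lra.
    by rewrite act_at1 mulrA.
  have stepn n z : p <= z < 1 -> 1 - act (x ^+ n)%g z <= m ^+ n * (1 - z).
    move=> zp; elim: n => [|n IH]; first by rewrite act1 ?expr0; lra.
    have z01 : 0 < z < 1 by lra.
    have ln := act_itvoo (x ^+ n)%g z01.
    have mn1 : m ^+ n <= 1 by rewrite exprn_ile1// ltW.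
    have pn : p <= act (x ^+ n)%g z < 1.
      apply/andP; split; last by lra.
      suff : m ^+ n * (1 - z) <= 1 - z by lra.
      by rewrite ler_piMl//; lra.
    rewrite expgS actM (le_trans (step _ pn))// exprS -mulrA ler_wpM2l//.
  have [n mnK] : exists n, (1 + K) * m ^+ n < 1.
    have : (fun k => m ^+ k) @ \oo --> (0 : R) by apply: cvg_expr; rewrite ger0_norm.
    move/cvgrPdist_lt => /(_ (1 + K)^-1) []; first by rewrite invr_gt0; lra.
    move=> n _ /(_ n (leqnn n)); rewrite /= sub0r normrN ger0_norm ?exprn_ge0//.
    by move=> mn; exists n; rewrite -ltr_pdivlMl ?mulr1//; lra.
  have [r r01 rP] := xc n.
  pose z := (Num.max r p + 1) / 2.
  have zP : r < z < 1 /\ p <= z < 1.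
    by rewrite /z; case: (leP r p) => rp; split; lra.
  have [/rP lt_xc zp] := zP.
  have : 1 - z <= (1 + K) * (1 - act c z).
    have : (act c 1 - act c 0) * (1 - z) <=
        (1 + K * (1 - 0)) * ((act c 1 - act c z) * (1 - 0)) by apply: distc; lra.
    by rewrite act_at1 act_at0 !subr0 mul1r !mulr1.
  have := stepn n z zp => stepz distz.
  have : (1 + K) * (1 - act c z) < (1 + K) * (m ^+ n * (1 - z)).
    by rewrite ltr_pM2l; lra.
  rewrite mulrA; have : (1 + K) * m ^+ n * (1 - z) < 1 - z by rewrite gtr_pMl; lra.
  lra.
pose l := Num.min (1/2) (e / 3).
pose p := 1 - l / (1 + L).
have l0 : 0 < l by rewrite /l lt_min; apply/andP; split; lra.
have l1 : l <= 1/2 /\ l <= e / 3 by rewrite /l !ge_min !lexx orbT.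
have lL : 0 < l / (1 + L) by rewrite divr_gt0//; lra.
have lL1 : l / (1 + L) <= l by rewrite ler_pdivrMr; nra.
have p01 : 0 < p < 1 by rewrite /p; lra.
exists p => [|s t ps st t1]; first by lra.
have Ll : L * (1 - p) <= l.
  by rewrite /p opprB addrC subrK mulrA ler_pdivrMr; nra.
have Ll0 : 0 <= L * (1 - p) by rewrite mulr_ge0//; lra.
have xst := act_lt x (_ : 0 <= s) st t1.
have := slope1 p p01.
have : (act x 1 - act x p) * (t - s) <=
    (1 + L * (1 - p)) * ((act x t - act x s) * (1 - p)) by apply: dist; lra.
rewrite act_at1; move: (L * (1 - p)) Ll Ll0 => D Dl D0.
have xp := act_itvoo x p01; have {}xst : 0 < act x t - act x s.
  by rewrite subr_gt0 xst//; lra.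
have P0 : 0 < 1 - p by lra.
have A0 : 0 < 1 - act x p by lra.
have T0 : 0 < t - s by lra.
move: (1 - p) (1 - act x p) (act x t - act x s) (t - s) P0 A0 xst T0.
move=> P A X T P0 A0 X0 T0 PA AT.
have TX : T <= (1 + D) ^+ 2 * X.
  rewrite -(ler_pM2l P0) (le_trans (_ : _ <= (1 + D) * A * T))//.
    by rewrite ler_wpM2r// ltW.
  rewrite -mulrA (le_trans (_ : _ <= (1 + D) * ((1 + D) * (X * P))))//.
    by rewrite ler_wpM2l//; lra.
  by rewrite le_eqVlt; apply/predU1P; left; ring.
have [e1|e1] := leP 1 e; first by nra.
have eD : (1 - e) * (1 + D) ^+ 2 <= 1 by nra.
rewrite (le_trans (ler_wpM2l _ TX)) ?mulrA ?ler_piMl//; lra.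
Qed.

Lemma orbit_itv r c t n : 0 <= r -> lt_on r 1%g c -> r < t < 1 ->
  r < act (c ^+ n)%g t < 1.
Proof.
move=> r0 cr tr; elim: n => [|n IH]; first by rewrite act1//; lra.
rewrite expgS actM; have := cr _ IH; rewrite act1; last by lra.
have := @act_itvoo _ c (act (c ^+ n)%g t); lra.
Qed.

(** The orbit cannot stay in the compact interval [[t, p]], where [c] moves every
    point by at least some [m > 0]. *)
Lemma orbit_to1 r c t p : 0 <= r -> lt_on r 1%g c -> r < t < 1 -> p < 1 ->
  exists n0, forall n, (n0 <= n)%N -> p < act (c ^+ n)%g t.
Proof.
move=> r0 cr tr p1; have orb n := orbit_itv n r0 cr tr.
have [pt|tp] := ltP p t.
  exists 0%N => n _; elim: n => [|n IH]; first by rewrite act1//; lra.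
  by rewrite expgS actM (lt_trans IH)// -[ltLHS]act1 ?cr//; have := orb n; lra.
have cid : {within `[t, p], continuous (fun z => act c z - z)}.
  apply: continuous_subspaceT => z; apply: cvgB; last exact: cvg_id.
  exact: act_continuous.
have [v] := EVT_min tp cid; rewrite in_itv/= => vtp vmin.
set m := act c v - v in vmin.
have m0 : 0 < m by rewrite subr_gt0 -[ltLHS]act1 ?cr//; lra.
have walk n : p < act (c ^+ n)%g t \/ t + m *+ n <= act (c ^+ n)%g t.
  elim: n => [|n IH]; first by right; rewrite addr0 act1//; lra.
  rewrite expgS actM; have orbn := orb n.
  have up : act (c ^+ n)%g t < act c (act (c ^+ n)%g t).
    by rewrite -[ltLHS]act1 ?cr//; lra.
  case: (ltP p (act (c ^+ n)%g t)) => [pn|np]; first by left; exact: lt_trans up.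
  case: IH => [|IH]; [lra|right].
  have := vmin (act (c ^+ n)%g t); rewrite in_itv/= mulrS => /(_ _).
  have mn0 : 0 <= m *+ n by rewrite mulrn_wge0// ltW.
  have -> : t <= act (c ^+ n)%g t <= p by apply/andP; split => //; lra.
  by move=> /(_ isT); rewrite -/m; lra.
have [n0 n0P] : exists n0, 1 < m *+ n0.
  exists (Num.bound m^-1); rewrite -mulr_natr -ltr_pdivrMl// mulr1.
  by apply: archi_boundP; rewrite invr_ge0 ltW.
exists n0 => n n0n; have [//|] := walk n; have := orb n.
have : m *+ n0 <= m *+ n by rewrite ler_wpMn2l// ltW.
lra.
Qed.

(** Close to [1], the points [y], [x y], ..., [x ^+ k y] all lie between [y] and
    [c y]; as [x] has slope almost [1] there, the [k] steps have almost the same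
    length, so each of them is about [k] times shorter than the step of [c]. *)
Lemma displacement_near1 x c (e : R) : germ_lt 1%g x ->
  (forall n, germ_lt (x ^+ n)%g c) -> 0 < e ->
  exists2 r, 0 <= r < 1 & forall y, r < y < 1 ->
    act x y - y <= e * (act c y - y).
Proof.
move=> [r1 r1P x_gt] xc e0.
have e2 : 0 < e / 2 by lra.
have [r2 r2P slope] := slope_near1 xc e2.
pose k := Num.bound (e / 2)^-1.
have ke : 1 < (e / 2) * k%:R.
  by rewrite -ltr_pdivrMl// mulr1 archi_boundP// invr_ge0 ltW.
have [r3 r3P xkc] := xc k.
exists (Num.max r1 (Num.max r2 r3)) => [|y].
  by rewrite le_max !gt_max; move: r1P r2P r3P => /andP[-> ->] /andP[_ ->] /andP[_ ->].
rewrite !gt_max => /andP[/and3P[r1y r2y r3y] y1].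
have y0 : r1 < y < 1 by rewrite r1y.
have r10 : 0 <= r1 by lra.
have orb n := orbit_itv n r10 x_gt y0.
set d := act c y - y; set u := act x y - y.
have up n : act (x ^+ n)%g y < act (x ^+ n.+1)%g y.
  rewrite expgS actM -[ltLHS]act1; last by have := orb n; lra.
  exact: x_gt.
have up_le m n : (m <= n)%N -> act (x ^+ m)%g y <= act (x ^+ n)%g y.
  move=> /subnKC <-; elim: (n - m)%N => [|j IH]; first by rewrite addn0.
  by rewrite addnS (le_trans IH)// ltW.
have yd n : (n <= k)%N -> act (x ^+ n)%g y - y <= d.
  move=> nk; have := up_le _ _ nk; have : act (x ^+ k)%g y < act c y.
    by apply: xkc; rewrite r3y.
  by rewrite /d; lra.
have walk n : (n <= k)%N -> (u - (e / 2) * d) *+ n <= act (x ^+ n)%g y - y.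
  elim: n => [_|n IH nk]; first by rewrite mulr0n act1; lra.
  have {}IH := IH (ltnW nk).
  have : u - (e / 2) * d <= act (x ^+ n.+1)%g y - act (x ^+ n)%g y.
    have dn := yd n (ltnW nk).
    rewrite expgS actM; case: (posnP n) => [->|n0].
      rewrite act1; last by lra.
      have : 0 <= d by have := yd 0%N (leq0n _); rewrite act1; lra.
      by rewrite /u => ?; rewrite lerBlDr lerDl mulr_ge0//; lra.
    have yn : y < act (x ^+ n)%g y.
      by have := lt_le_trans (up 0%N) (up_le 1%N _ n0); rewrite act1; lra.
    have xn1 : act (x ^+ n)%g y <= 1 by have := orb n; lra.
    have := slope _ _ (ltW r2y) yn xn1; have := ler_wpM2l (ltW e2) dn.
    by rewrite /u; lra.
  by move=> step; rewrite mulrSr (le_trans (lerD IH step))//; lra.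
have := walk k (leqnn k); have := yd k (leqnn k); rewrite -mulr_natr.
have : 0 < u by rewrite subr_gt0 -[ltLHS]act1 ?x_gt//; lra.
nra.
Qed.

(** The proportion of [[t, a]] in the fundamental domain [[t, c t]] is distorted by
    [c ^+ n] by a factor which does not depend on [n]: the images of the fundamental
    domain are disjoint, so the errors [1 + L * length] multiply up to the
    exponential of [L] times their total length. *)
Lemma distortion_iter c : exists2 L, 0 <= L & forall r t a n, 0 <= r ->
  lt_on r 1%g c -> r < t < 1 -> t < a < act c t ->
  (act (c ^+ n.+1)%g t - act (c ^+ n)%g t) * (a - t) <=
  expR (L * (act (c ^+ n)%g t - t)) *
    ((act (c ^+ n)%g a - act (c ^+ n)%g t) * (act c t - t)).
Proof.
have [L L0 dist] := bounded_distortion c; exists L => // r t a n r0 cr tr ta.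
have orb n' := orbit_itv n' r0 cr tr.
have aP : 0 <= a <= 1 by have := orb 1%N; rewrite expg1; lra.
elim: n => [|n IH].
  by rewrite expg1 !act1 ?subrr ?mulr0 ?expR0 ?mul1r 1?mulrC//; lra.
have yS m : act (c ^+ m.+1)%g t = act (c ^+ m)%g (act c t) by rewrite expgSr actM.
have [y0 y1] := (orb n, orb n.+1).
have ab : act (c ^+ n)%g t < act (c ^+ n)%g a < act (c ^+ n.+1)%g t.
  by rewrite yS; have := orb 1%N; rewrite expg1 => ct; rewrite !act_lt//; lra.
have : (act c (act (c ^+ n.+1)%g t) - act c (act (c ^+ n)%g t)) *
    (act (c ^+ n)%g a - act (c ^+ n)%g t) <=
    (1 + L * (act (c ^+ n.+1)%g t - act (c ^+ n)%g t)) *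
    ((act c (act (c ^+ n)%g a) - act c (act (c ^+ n)%g t)) *
     (act (c ^+ n.+1)%g t - act (c ^+ n)%g t)).
  by apply: dist; lra.
rewrite -!actM -!expgS.
have : 0 < act (c ^+ n.+1)%g a - act (c ^+ n.+1)%g t.
  by rewrite subr_gt0 act_lt//; lra.
have := expR_ge1Dx (L * (act (c ^+ n.+1)%g t - act (c ^+ n)%g t)).
have -> : L * (act (c ^+ n.+1)%g t - t) = L * (act (c ^+ n.+1)%g t - act (c ^+ n)%g t)
  + L * (act (c ^+ n)%g t - t) by ring.
rewrite expRD.
have b0 : 0 < act (c ^+ n)%g a - act (c ^+ n)%g t by lra.
have a0 : 0 < a - t by lra.
have c0 : 0 < act c t - t by lra.
have l0 : 0 < act (c ^+ n.+1)%g t - act (c ^+ n)%g t by lra.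
have L1 : 0 <= 1 + L * (act (c ^+ n.+1)%g t - act (c ^+ n)%g t).
  by rewrite addr_ge0// mulr_ge0// ltW.
move: (expR_gt0 (L * (act (c ^+ n)%g t - t))) b0 a0 c0 l0 L1 IH.
move: (expR (L * (act (c ^+ n.+1)%g t - act (c ^+ n)%g t))) => E1.
move: (expR (L * (act (c ^+ n)%g t - t))) => E.
move: (1 + L * _) => F.
move: (act (c ^+ n)%g a - act (c ^+ n)%g t) => b.
move: (act (c ^+ n.+1)%g t - act (c ^+ n)%g t) => l.
move: (act (c ^+ n.+2)%g t - act (c ^+ n.+1)%g t) => l'.
move: (act (c ^+ n.+1)%g a - act (c ^+ n.+1)%g t) => b'.
move: (a - t) (act c t - t) => A C E0 b0 A0 C0 l0 F0 IH FE b'0 step.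
rewrite -(ler_pM2r b0).
apply: (le_trans (_ : _ <= F * (b' * l) * A)).
  by rewrite mulrAC ler_pM2r.
apply: (le_trans (_ : _ <= F * b' * (E * (b * C)))).
  have -> : F * (b' * l) * A = F * b' * (l * A) by ring.
  by rewrite ler_wpM2l// mulr_ge0// ltW.
have -> : E1 * E * (b' * C) * b = E1 * (b' * (E * (b * C))) by ring.
by rewrite -mulrA ler_wpM2r// !mulr_ge0// ltW.
Qed.

(** The map [c ^+ n] sends [[t, c t]] to a fundamental domain [[y, c y]] close to [1],
    in which [[y, x y]] takes up a vanishing proportion; by bounded distortion, so
    does its preimage, which is the interval from [t] to its image by the
    conjugate. *)
Lemma kopell_cvg x c r t (e : R) : germ_lt 1%g x ->
  (forall n, germ_lt (x ^+ n)%g c) -> 0 <= r -> lt_on r 1%g c ->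
  r < t < 1 -> 0 < e ->
  exists n0, forall n, (n0 <= n)%N -> t < act (x ^ (c ^+ n))%g t < t + e.
Proof.
move=> [r1 r1P x_gt] xc r0 cr tr e0.
have [L L0 dist] := distortion_iter c.
have [r2 r2P disp] := displacement_near1 (ex_intro2 _ _ r1 r1P x_gt) xc
  (divr_gt0 e0 (expR_gt0 L)).
have [r3 r3P xltc] := xc 1%N.
have [[/andP[_ r11] /andP[_ r21]] /andP[_ r31]] := (r1P, r2P, r3P).
have [n1 n1P] := orbit_to1 r0 cr tr r11.
have [n2 n2P] := orbit_to1 r0 cr tr r21.
have [n3 n3P] := orbit_to1 r0 cr tr r31.
exists (maxn n1 (maxn n2 n3)) => n; rewrite !geq_max => /and3P[/n1P yr1 /n2P yr2 /n3P yr3].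
have yn := orbit_itv n r0 cr tr.
have ct := orbit_itv 1 r0 cr tr; rewrite expg1 in ct.
set y := act (c ^+ n)%g t in yn yr1 yr2 yr3.
have yxy : y < act x y by rewrite -[ltLHS]act1 ?x_gt//; lra.
have xycy : act x y < act c y by rewrite xltc//; lra.
set a := act (x ^ (c ^+ n))%g t.
have aE : act (c ^+ n)%g a = act x y.
  by rewrite -actM /conjg mulVKg actM.
have a01 : 0 <= a <= 1 by exact: act_itv.
have ta : t < a < act c t.
  apply/andP; split.
    rewrite ltNge; apply/negP => /(act_le (c ^+ n)%g).
    by rewrite aE -/y => /(_ _ _); lra.
  rewrite ltNge; apply/negP => /(act_le (c ^+ n)%g).
  by rewrite aE -actM -expgSr expgS actM -/y => /(_ _ _); lra.
have := dist r t a n r0 cr tr ta.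
rewrite -/y aE expgS actM -/y => dista.
apply/andP; split; first by lra.
have /disp : r2 < y < 1 by lra.
rewrite mulrAC ler_pdivlMr ?expR_gt0// => dispy.
have Ely : expR (L * (y - t)) <= expR L.
  by rewrite ler_expR ler_piMr//; lra.
have D0 : 0 < act c y - y by lra.
rewrite -ltrBlDl -(ltr_pM2l D0) (le_lt_trans dista)//.
apply: (@le_lt_trans _ _ ((act x y - y) * expR L * (act c t - t))).
  rewrite mulrA [_ * (act x y - y)]mulrC ler_pM2r; last by lra.
  by rewrite ler_pM2l//; lra.
apply: (@le_lt_trans _ _ (e * (act c y - y) * (act c t - t))).
  by rewrite ler_pM2r//; lra.
rewrite [_ * e]mulrC -[ltRHS]mulr1 ltr_pM2l; first by lra.
exact: mulr_gt0.
Qed.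

End Kopell.

(** * The order of germs at the endpoint *)

Section GermOrder.
Context {R : realType}.
Implicit Types (f g h : Diff2 R) (r t : R).

Lemma germ_lt_irr f : ~ germ_lt f f.
Proof.
by move=> [r r01 /(_ ((r + 1) / 2))]; rewrite ltxx => /(_ _)/notF; apply; lra.
Qed.

Lemma germ_lt_both f g f' g' : germ_lt f g -> germ_lt f' g' ->
  exists2 r, 0 <= r < 1 & lt_on r f g /\ lt_on r f' g'.
Proof.
move=> [r r01 rP] [q q01 qP]; exists (Num.max r q).
  by rewrite le_max gt_max; move: r01 q01 => /andP[-> ->] /andP[_ ->].
by split=> t; rewrite gt_max => tP; [apply: rP|apply: qP]; move: tP; lra.
Qed.

Lemma germ_lt_trans g f h : germ_lt f g -> germ_lt g h -> germ_lt f h.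
Proof.
move=> fg gh; have [r r01 [fgr ghr]] := germ_lt_both fg gh.
by exists r => // t rt; exact: lt_trans (fgr t rt) (ghr t rt).
Qed.

Lemma germ_ltM2l h f g : germ_lt f g -> germ_lt (h * f)%g (h * g)%g.
Proof.
move=> [r r01 rP]; exists r => // t rt; rewrite !actM act_lt ?rP//.
  by have := act_itv f t; lra.
by have := act_itv g t; lra.
Qed.

Lemma germ_ltM2r h f g : germ_lt f g -> germ_lt (f * h)%g (g * h)%g.
Proof.
move=> [r r01 rP]; exists (act h^-1%g r) => [|t /andP[rt t1]].
  have := act_itv h^-1%g r; have := @act_lt _ h^-1%g r 1; rewrite act_at1.
  by move=> /(_ _ _ _); lra.
have t01 : 0 <= t <= 1 by have := act_itv h^-1%g r; lra.
rewrite !actM; apply: rP; apply/andP; split.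
  rewrite -(actVK h (_ : 0 <= r <= 1)); last by lra.
  by rewrite act_lt//; have := act_itv h^-1%g r; lra.
by rewrite -(act_at1 h) act_lt//; lra.
Qed.

Lemma finite_near1 (A : set (itv01 R)) : finite_set A ->
  exists2 r, 0 <= r < 1 & forall x, A x -> \val x < 1 -> \val x <= r.
Proof.
move=> /finite_seqP[s ->]; elim: s => [|x s [r r01 IH]]; first by exists 0 => //; lra.
have [x1|x1] := ltP (\val x) 1; last first.
  exists r => // y /=; rewrite inE => /predU1P[->|ys]; first by rewrite ltNge x1.
  exact: IH.
exists (Num.max r (\val x)).
  by rewrite le_max gt_max x1; move: r01 => /andP[-> ->].
move=> y /=; rewrite inE le_max => /predU1P[->|ys y1]; first by rewrite lexx orbT.
by rewrite IH.
Qed.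

Lemma act_IVT f g s t : 0 <= s -> s < t -> t <= 1 ->
  (act g s - act f s) * (act g t - act f t) < 0 ->
  exists2 z, s < z < t & act f z = act g z.
Proof.
move=> s0 st t1 neg.
have cfg : {within `[s, t], continuous (fun z => act g z - act f z)}.
  by apply: continuous_subspaceT => z; apply: cvgB; exact: act_continuous.
have [|z] := IVT (ltW st) cfg (v := 0).
  rewrite ge_min le_max; move: neg.
  case: (ltrgt0P (act g s - act f s)) => [a0|a0|->]; last by rewrite mul0r ltxx.
    by rewrite pmulr_rlt0// => /ltW ->; rewrite orbT.
  by rewrite nmulr_rlt0// => /ltW ->; rewrite orbT.
rewrite in_itv/= => /andP[sz zt] /eqP; rewrite subr_eq0 => /eqP fg.
exists z; last by [].
rewrite !lt_def sz zt !andbT; apply/andP; split; apply: contraTneq neg => zE.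
  by rewrite -zE fg subrr mul0r ltxx.
by rewrite zE fg subrr mulr0 ltxx.
Qed.

(** A point where [f] and [g] agree is a fixed point of [f^-1 * g], and there is no
    such point close to [1]; hence [g - f] has constant sign there. *)
Lemma germ_lt_total f g : finite_set (fixed_points (f^-1 * g)%g) ->
  germ_lt f g \/ germ_lt g f.
Proof.
move=> /finite_near1[r r01 rP].
have nofix t : r < t < 1 -> act f t <> act g t.
  move=> rt fgt; have t01 : 0 <= t <= 1 by lra.
  have : \val (pt t) <= r; last by rewrite val_pt//; lra.
  apply: rP; rewrite ?val_pt//; [|lra]; split; first by rewrite val_pt//; lra.
  by apply/val_inj; rewrite [RHS]val_pt// -[RHS](actK f t01) fgt -actM.
have same s t : r < s < 1 -> r < t < 1 -> act f s < act g s -> act f t < act g t.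
  move=> rs rt fgs; rewrite ltNge le_eqVlt; apply/negP => /predU1P[/esym|]; first exact: nofix.
  move=> gft; have neg : (act g s - act f s) * (act g t - act f t) < 0.
    by rewrite pmulr_rlt0 ?subr_lt0 ?subr_gt0.
  have [st|ts|stE] := ltgtP s t; last by move: fgs gft; rewrite stE; lra.
  - by have [||z zP /nofix] := act_IVT _ st _ neg; [lra..|apply; lra].
  - rewrite mulrC in neg.
    by have [||z zP /nofix] := act_IVT _ ts _ neg; [lra..|apply; lra].
pose m := (r + 1) / 2; have rm : r < m < 1 by rewrite /m; lra.
case: (ltgtP (act f m) (act g m)) => [fg|gf|/(nofix _ rm)//].
  by left; exists r => // t rt; exact: same fg.
right; exists r => // t rt; rewrite ltNge le_eqVlt; apply/negP => /predU1P[|]; first exact: nofix.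
by move=> /(same _ _ rt rm); lra.
Qed.

End GermOrder.

(** Finiteness of the fixed point sets makes the order of germs total. The subgroup
    is made into a type of its own so that it can carry the structure of a
    bi-ordered group. *)
Record finfix_group (R : realType) := FinfixGroup {
  finfix_carrier : set (Diff2 R);
  finfix_subgroup : subgroup finfix_carrier;
  finfix_finite : forall f, finfix_carrier f -> f <> 1%g ->
    finite_set (fixed_points f) }.

Definition elt (R : realType) (S : finfix_group R) : Type :=
  set_type (finfix_carrier S).

Section EltGroup.
Context {R : realType} (S : finfix_group R).
Implicit Types x y z : elt S.

Lemma eltP x : finfix_carrier S (\val x).
Proof. exact: set_mem (valP x). Qed.

Definition mk_elt f (Sf : finfix_carrier S f) : elt S := exist _ f (mem_set Sf).

Fact finfix1 : finfix_carrier S 1%g.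
Proof. by have [] := finfix_subgroup S. Qed.
Fact finfixM f g : finfix_carrier S f -> finfix_carrier S g -> finfix_carrier S (f * g)%g.
Proof. by have [_ + _] := finfix_subgroup S; apply. Qed.
Fact finfixV f : finfix_carrier S f -> finfix_carrier S f^-1%g.
Proof. by have [_ _] := finfix_subgroup S; apply. Qed.

Definition elt_one : elt S := mk_elt finfix1.
Definition elt_mul x y : elt S := mk_elt (finfixM (eltP x) (eltP y)).
Definition elt_inv x : elt S := mk_elt (finfixV (eltP x)).

Fact elt_mulA : associative elt_mul.
Proof. by move=> x y z; apply/val_inj/mulgA. Qed.
Fact elt_mul1 : left_id elt_one elt_mul.
Proof. by move=> x; apply/val_inj/mul1g. Qed.
Fact elt_mulr1 : right_id elt_one elt_mul.
Proof. by move=> x; apply/val_inj/mulg1. Qed.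
Fact elt_mulV : left_inverse elt_one elt_inv elt_mul.
Proof. by move=> x; apply/val_inj/mulVg. Qed.
Fact elt_mulrV : right_inverse elt_one elt_inv elt_mul.
Proof. by move=> x; apply/val_inj/mulgV. Qed.

Definition elt_lt x y := `[< germ_lt (\val x) (\val y) >].

Fact elt_lt_irr : irreflexive elt_lt.
Proof. by move=> x; apply/negbTE/asboolPn/germ_lt_irr. Qed.
Fact elt_lt_trans : transitive elt_lt.
Proof. by move=> y x z /asboolP xy /asboolP yz; apply/asboolP/(germ_lt_trans xy). Qed.
Fact elt_lt_total x y : x != y -> elt_lt x y || elt_lt y x.
Proof.
move=> xy; have /germ_lt_total : finite_set (fixed_points ((\val x)^-1 * \val y)%g).
  apply: (@finfix_finite _ S); first by apply: finfixM (eltP y); exact/finfixV/eltP.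
  move=> /(congr1 (fun h => (\val x * h)%g)); rewrite mulVKg mulg1 => /val_inj yx.
  by rewrite yx eqxx in xy.
by case=> /asboolP h; rewrite /elt_lt h ?orbT.
Qed.

End EltGroup.

Fact germ_display : Order.disp_t. Proof. exact: Order.Disp tt tt. Qed.

HB.instance Definition _ R (S : finfix_group R) := Choice.on (elt S).
HB.instance Definition _ R (S : finfix_group R) := isGroup.Build (elt S)
  (@elt_mulA _ S) (@elt_mul1 _ S) (@elt_mulr1 _ S) (@elt_mulV _ S) (@elt_mulrV _ S).
HB.instance Definition _ R (S : finfix_group R) :=
  Order.Lt_isPOrder.Build germ_display (elt S) (@elt_lt_irr _ S) (@elt_lt_trans _ S).

Fact elt_le_total R (S : finfix_group R) : total (<=%O : rel (elt S)).
Proof.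
move=> x y; rewrite !le_eqVlt; have [->|/elt_lt_total] := eqVneq x y; first by [].
by case/orP => h; apply/orP; [left|right]; apply/orP; right.
Qed.
HB.instance Definition _ R (S : finfix_group R) :=
  Order.POrder_isTotal.Build germ_display (elt S) (@elt_le_total _ S).

Fact elt_ltM2l R (S : finfix_group R) (z x y : elt S) :
  (x < y)%O -> (z * x < z * y)%g%O.
Proof. by move=> /asboolP xy; apply/asboolP/germ_ltM2l. Qed.
Fact elt_ltM2r R (S : finfix_group R) (z x y : elt S) :
  (x < y)%O -> (x * z < y * z)%g%O.
Proof. by move=> /asboolP xy; apply/asboolP/germ_ltM2r. Qed.

HB.instance Definition _ R (S : finfix_group R) :=
  isBiOrdered.Build germ_display (elt S) (@elt_ltM2l _ S) (@elt_ltM2r _ S).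

(** * Creating sign changes *)

Section EltTheory.
Context {R : realType} {S : finfix_group R}.
Implicit Types (u v c e x y z : elt S) (r t : R).
Local Notation "x ≪ y" := (infsmall x y) (at level 70).

Lemma val_eltM x y : \val (x * y)%g = (\val x * \val y)%g.
Proof. by []. Qed.

Lemma val_eltX x n : \val (x ^+ n)%g = (\val x ^+ n)%g.
Proof. by elim: n => // n IH; rewrite !expgS val_eltM IH. Qed.

Lemma val_eltJ x y : \val (x ^ y)%g = (\val x ^ \val y)%g.
Proof. by []. Qed.

Lemma actJ (f g : Diff2 R) t : act (f ^ g)%g t = act g^-1%g (act f (act g t)).
Proof. by rewrite /conjg !actM. Qed.

Lemma elt_ltP x y : reflect (germ_lt (\val x) (\val y)) (x < y)%O.
Proof. exact: asboolP. Qed.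

Lemma infsmall_germ x y : x ≪ y -> forall n, germ_lt (\val x ^+ n)%g (\val y).
Proof. by move=> xy n; rewrite -val_eltX; apply/elt_ltP/xy. Qed.

(** If the germ of [x ^ c] were above that of [x], the displacement of
    [x ^ (c ^+ n)] would not decrease with [n], against [kopell_cvg]. *)
Lemma elt_conj_lt c x : (1 < x)%g%O -> x ≪ c -> (x ^ c < x)%g%O.
Proof.
move=> x1 xc; rewrite ltNge le_eqVlt; apply/negP => xle.
have [r r01 [x_gt c_gt xler]] : exists2 r, 0 <= r < 1 &
    [/\ lt_on r 1%g (\val x), lt_on r 1%g (\val c) &
     forall t, r < t < 1 -> act (\val x) t <= act (\val (x ^ c)%g) t].
  have c1 := infsmall_gt1 xc.
  have [r r01 [xr cr]] := germ_lt_both (elt_ltP _ _ x1) (elt_ltP _ _ c1).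
  case/predU1P: xle => [xE|/elt_ltP[q q01 qP]].
    by exists r => //; split=> // t _; rewrite -xE.
  exists (Num.max r q); first by rewrite le_max gt_max; move: r01 q01 => /andP[-> ->] /andP[_ ->].
  by split=> t; rewrite gt_max -andbA => /and3P[rt qt t1]; [apply: xr|apply: cr|apply/ltW/qP]; rewrite ?rt ?qt.
have r0 : 0 <= r by lra.
have xler_n n t : r < t < 1 -> act (\val x) t <= act (\val x ^ (\val c ^+ n))%g t.
  elim: n t => [|n IH] t rt; first by rewrite conjg1.
  have := xler t rt; rewrite val_eltJ actJ => /le_trans; apply.
  rewrite expgSr conjgM [leRHS]actJ.
  have ct : r < act (\val c) t < 1 by have := orbit_itv 1 r0 c_gt rt; rewrite expg1.
  have [x01 xn01] := (act_itv (\val x) (act (\val c) t),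
    act_itv (\val x ^ (\val c ^+ n))%g (act (\val c) t)).
  by apply: act_le; [lra|exact: IH|lra].
pose t := (r + 1) / 2; have rt : r < t < 1 by rewrite /t; lra.
have xt : 0 < act (\val x) t - t by rewrite subr_gt0 -[ltLHS]act1 ?x_gt//; lra.
have [n nP] := kopell_cvg (elt_ltP _ _ x1) (infsmall_germ xc) r0 c_gt rt xt.
by have := nP n (leqnn n); have := xler_n n t rt; lra.
Qed.

(** The points are listed from the one closest to [1], since new points are added
    on that side. *)
Definition alternates u : seq R -> bool :=
  sorted (fun a b => (b < a) &&
    ((act (\val u) a - a) * (act (\val u) b - b) < 0)).

Lemma alternates_sub u w l :
  {in l &, forall a b, 0 < (act (\val w) a - a) * (act (\val u) a - a) *
                          ((act (\val w) b - b) * (act (\val u) b - b))} ->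
  alternates u l -> alternates w l.
Proof.
move=> wu; apply: (@sub_in_sorted _ (mem l)); last exact/allP.
move=> a b al bl /= /andP[-> uab] /=; have := wu a b al bl.
by rewrite mulrACA mulrC nmulr_rgt0.
Qed.

Lemma act_inv_sign (f : Diff2 R) t : 0 <= t <= 1 -> act f t != t ->
  (act f^-1%g t - t) * (act f t - t) < 0.
Proof.
move=> t01; have ft := act_itv f t; rewrite neq_lt => /orP[ltf|gtf].
  rewrite pmulr_rlt0 ?subr_lt0//; rewrite subr_gt0 -[ltLHS](actK f t01).
  by apply: act_lt; lra.
rewrite nmulr_rlt0 ?subr_gt0//; rewrite subr_lt0 -[ltRHS](actK f t01).
by apply: act_lt; lra.
Qed.

Lemma eventually_all_seq (T : eqType) (P : nat -> T -> Prop) (l : seq T) :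
  (forall k, k \in l -> exists n0, forall n, (n0 <= n)%N -> P n k) ->
  exists n0, forall n k, (n0 <= n)%N -> k \in l -> P n k.
Proof.
elim: l => [|a l IH] lP; first by exists 0%N.
have [n0 n0P] := lP a (mem_head a l).
have [|n1 n1P] := IH; first by move=> t tl; apply: lP; rewrite inE tl orbT.
exists (maxn n0 n1) => n t; rewrite geq_max inE => /andP[n0n n1n] /predU1P[->|tl].
  exact: n0P.
exact: n1P.
Qed.

(** Composing with a small enough map keeps the sign of [u t - t]. *)
Lemma small_comp_sign u t : act (\val u) t != t -> exists2 d, 0 < d &
  forall z : R, t < z < t + d -> 0 < (act (\val u) z - t) * (act (\val u) t - t).
Proof.
move=> ut; have /cvgrPdist_lt := @act_continuous _ (\val u) t.
move=> /(_ `|act (\val u) t - t|); rewrite normr_gt0 subr_eq0 => /(_ ut).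
move=> /nbhs_ballP[d /= d0 dP]; exists d => // z /andP[tz zd].
have : ball t d z by rewrite /ball/= ltr_distlC; lra.
move=> /dP /=; move: (act (\val u) z) => y.
have [ugt|ult] := ltP t (act (\val u) t).
  by rewrite [`|_ - t|]gtr0_norm ?subr_gt0// ltr_distlC => yP; rewrite mulr_gt0//; lra.
rewrite [`|_ - t|]ler0_norm ?subr_le0// ltr_distlC => yP; rewrite nmulr_lgt0; first by lra.
by rewrite subr_lt0 lt_neqAle ut.
Qed.

(** Induction on the number [m] of sign changes. The index [i] is general because a
    step from the class of [s i.+1] ends in the larger class of [s i]; [u] and its
    inverse are both bounded because the step may have to start from [u^-1]. *)
Lemma alternating_exists r e (s : nat -> elt S) : 0 <= r < 1 -> lt_on r 1%g (\val e) ->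
  (forall i, 1 < s i)%g%O -> (forall i, s i ≪ e) ->
  (forall i n, s i.+1 ≪ s i ^ (e ^+ n))%g ->
  forall m i, exists u l, [/\ (u <= s i ^+ 2)%g%O, (u^-1 <= s i ^+ 2)%g%O, size l = m.+1 &
    all (fun t => (r < t < 1) && (act (\val u) t != t)) l && alternates u l].
Proof.
move=> r01 e_gt s1 se sS; elim=> [|m IH] i.
  have /elt_ltP[q q01 sq] := s1 i.
  exists (s i), [:: (Num.max r q + 1) / 2].
  have s2 : (s i <= s i ^+ 2)%g%O by rewrite -[leLHS]expg1 legX_homo// ltW.
  have sV : ((s i)^-1 < s i)%g%O by apply: (lt_trans _ (s1 i)); rewrite ltgV1.
  split => //; first exact: le_trans (ltW sV) s2.
  have [mr mq m1] : [/\ r <= Num.max r q, q <= Num.max r q & Num.max r q < 1].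
    by rewrite !le_max !lexx orbT gt_max; split=> //; lra.
  rewrite /= !andbT; apply/andP; split; first by lra.
  have := sq ((Num.max r q + 1) / 2); rewrite act1; last by lra.
  by move=> h; rewrite gt_eqF// h//; lra.
have [u [[|a l] [us Vus [sz] ual]]] := IH i.+1; first by [].
(* [u^-1] alternates at the same points, with the opposite signs. *)
wlog ua : u us Vus ual / act (\val u) a < a.
  move=> wlog_u; have /andP[/allP lP alt] := ual.
  have [ua|ua|ua] := ltgtP (act (\val u) a) a; first exact: (wlog_u u).
    have sgV t : t \in a :: l -> (act (\val u^-1%g) t - t) * (act (\val u) t - t) < 0.
      by move=> /lP/andP[rt utt]; apply: act_inv_sign => //; lra.
    apply: (wlog_u u^-1%g) => //; first by rewrite invgK.
      apply/andP; split; last first.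
        by apply: alternates_sub alt => b c bl cl; rewrite nmulr_rgt0 sgV.
      apply/allP => t tl; have /lP/andP[-> _] := tl.
      by have := sgV t tl; apply: contraTneq => ->; rewrite subrr mul0r ltxx.
    have := sgV a (mem_head a l); rewrite pmulr_llt0 ?subr_lt0 ?subr_gt0//.
  by have /lP/andP[_] := mem_head a l; rewrite ua eqxx.
have /andP[/allP lP alt] := ual.
pose v n := (s i ^ (e ^+ n))%g.
have [n nP] : exists n, forall t, t \in a :: l ->
    0 < (act (\val (u * v n)%g) t - t) * (act (\val u) t - t).
  have [|n0 n0P] := @eventually_all_seq _ (fun n t =>
    0 < (act (\val (u * v n)%g) t - t) * (act (\val u) t - t)) (a :: l).
    move=> t /lP/andP[rt utt]; have [d d0 dP] := small_comp_sign utt.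
    have r0 : 0 <= r by lra.
    have [n0 n0P] := kopell_cvg (elt_ltP _ _ (s1 i)) (infsmall_germ (se i)) r0 e_gt rt d0.
    exists n0 => n /n0P vt; rewrite val_eltM actM; apply: dP.
    by rewrite val_eltJ val_eltX.
  by exists n0 => t; exact: n0P.
(* Near [1], [v n] dominates [u^-1], whence one more sign change. *)
have uv1 : (1 < u * v n)%g%O.
  by rewrite -(ltgM2l u^-1%g) mulg1 mulKg (le_lt_trans Vus)//; exact: sS.
have /elt_ltP[q q01 uvq] := uv1.
have a01 : r < a < 1 by have /lP/andP[] := mem_head a l.
have [mr mq m1] : [/\ a <= Num.max a q, q <= Num.max a q & Num.max a q < 1].
  by rewrite !le_max !lexx orbT gt_max; split=> //; lra.
pose z := (Num.max a q + 1) / 2; have zP : [/\ a < z, q < z & z < 1] by rewrite /z; split; lra.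
have uvz : z < act (\val (u * v n)%g) z.
  have [az qz z1] := zP; have := uvq z; rewrite act1; last by lra.
  by apply; rewrite qz.
have vs : (v n <= s i)%g%O by apply: conjX_le => //; exact: elt_conj_lt.
have uv_le : (u * v n <= s i ^+ 2)%g%O.
  rewrite expg2 legM// (le_trans us)// (le_trans _ vs)// ltW//; exact: sS.
exists (u * v n)%g, [:: z, a & l]; split=> //.
- rewrite (le_trans _ uv_le)// ltW// (lt_trans _ uv1)// ltgV1//.
- by rewrite /= sz.
have [az qz z1] := zP.
have walt : alternates (u * v n)%g (a :: l).
  by apply: alternates_sub alt => b c bl cl; rewrite mulr_gt0// nP.
have wP : all (fun t => (r < t < 1) && (act (\val (u * v n)%g) t != t)) (a :: l).
  apply/allP => t tl; have /lP/andP[-> _] := tl.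
  by have := nP t tl; apply: contraTneq => ->; rewrite subrr mul0r ltxx.
apply/andP; split.
  rewrite [all _ _]/= -/(all _ (a :: l)).
  rewrite wP andbT; apply/andP; split; first by lra.
  by rewrite gt_eqF.
rewrite /alternates [sorted _ _]/= -/(sorted _ (a :: l)).
apply/andP; split; last exact: walt.
rewrite az/= pmulr_rlt0 ?subr_gt0//.
by have := nP a (mem_head a l); rewrite nmulr_lgt0 ?subr_lt0.
Qed.

End EltTheory.

(** * Counting fixed points *)

Section Count.
Context {R : realType}.

Lemma alternates_fixed (S : finfix_group R) (u : elt S) a l :
  all (fun t => 0 < t < 1) (a :: l) -> alternates u (a :: l) ->
  exists zs : seq R, [/\ size zs = size l, uniq zs, all (fun z => z < a) zs &
    all (fun z => (0 < z < 1) && (act (\val u) z == z)) zs].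
Proof.
elim: l a => [|b l IH] a; first by exists [::].
rewrite /alternates /= => /andP[a01 l01] /andP[/andP[ba neg] alt].
have [zs [zsl zsU zsb zsP]] := IH b l01 alt.
have b01 : 0 < b < 1 by have /andP[] := l01.
have neg' : (act (\val u) b - act 1%g b) * (act (\val u) a - act 1%g a) < 0.
  by rewrite !act1 1?mulrC//; lra.
have [||z zab zE] := act_IVT _ ba _ neg'; [lra..|].
exists (z :: zs); rewrite /= zsl zsU zsP; split=> //.
- by rewrite andbT; apply/negP => /(allP zsb); lra.
- apply/andP; split; first by lra.
  by apply: sub_all zsb => c; lra.
- by rewrite -zE act1 ?eqxx; lra.
Qed.

Lemma fixed_points_size (f : Diff2 R) N (zs : seq R) :
  (fixed_points f #<= `I_N)%card -> uniq zs ->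
  all (fun z => (0 < z < 1) && (act f z == z)) zs -> (size zs <= N)%N.
Proof.
move=> fN zsU /allP zsP; rewrite -card_le_II; apply: card_le_trans fN.
pose g i := pt (nth 0 zs i).
have gP i : (i < size zs)%N -> \val (g i) = nth 0 zs i.
  by move=> /(mem_nth 0)/zsP/andP[z01 _]; rewrite val_pt//; lra.
have gI : (g @` `I_(size zs) #= `I_(size zs))%card.
  apply: inj_card_eq => i j; rewrite !inE /= => il jl gij.
  by apply/eqP; rewrite -(nth_uniq 0 il jl zsU) -!gP// gij.
rewrite -(card_le_eql gI); apply: subset_card_le => _ [i il <-]; have /zsP/andP[z01 /eqP zE] := mem_nth 0 il.
by split; [rewrite gP|apply/val_inj; rewrite [RHS]gP].
Qed.

End Count.

Lemma metaabelian_carrier (R : realType) (S : finfix_group R) :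
  metaabelian [set: elt S] -> metaabelian (finfix_carrier S).
Proof.
move=> mS; pose D := commutator_subgroup [set: elt S] [set: elt S].
have [D1 DM DV] : subgroup D by exact: subgroup_commutator.
have lift f : commutator_subgroup (finfix_carrier S) (finfix_carrier S) f ->
    exists2 x, D x & \val x = f.
  pose K : set (Diff2 R) := [set f | exists2 x, D x & \val x = f].
  move=> Ef; apply: (Ef K); split; first split.
  - by exists 1%g.
  - by move=> _ _ [x Dx <-] [y Dy <-]; exists (x * y)%g; first exact: DM.
  - by move=> _ [x Dx <-]; exists (x^-1)%g; first exact: DV.
  - move=> _ [f0 Sf [g0 Sg <-]]; exists [~ mk_elt Sf, mk_elt Sg]%g => //.
    exact: mem_commutator.
apply: metaabelian_commg => _ _ /lift[x Dx <-] /lift[y Dy <-].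
have : derived_series [set: elt S] 2 [~ x, y]%g by exact: mem_commutator.
by rewrite mS => /(congr1 \val).
Qed.

Theorem theorem0p2 (R : realType) (N : nat) (Gamma : set (Diff2 R)) :
  subgroup Gamma ->
  (forall f : Diff2 R, Gamma f -> f <> 1%g -> (fixed_points f #<= `I_N)%card) ->
  metaabelian Gamma.
Proof.
move=> sG finG.
have fixfin f : Gamma f -> f <> 1%g -> finite_set (fixed_points f).
  by move=> Gf f1; apply/finite_set_leP; exists N; exact: finG.
pose S := FinfixGroup sG fixfin.
apply: (@metaabelian_carrier R S); apply: metaabelian_rank_le2 => a b c a1 ab bc.
have [e [s [s1 se sS]]] := chain_exists (@elt_conj_lt R S) a1 ab bc.
have /elt_ltP[r r01 e_gt] := infsmall_gt1 (se 0%N).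
have [u [[|z l] [_ _ [sz] /andP[lP alt]]]] :=
  alternating_exists r01 e_gt s1 se sS N.+1 0; first by [].
have [|zs [zsl zsU _ zsP]] := alternates_fixed _ alt.
  by apply: sub_all lP => t; lra.
have u1 : \val u <> 1%g.
  move=> uE; have /andP[z01] := allP lP z (mem_head z l).
  by rewrite uE act1 ?eqxx//; lra.
have := fixed_points_size (finG _ (eltP u) u1) zsU zsP.
by rewrite zsl sz ltnn.
Qed.
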